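(* Let $(\Omega,\mathcal{A},\mathbb{P})$ be a probability space and $k\colon\Omega\times\mathbb{R}\times\mathbb{R}\to\mathbb{R}$ jointly measurable, with mean kernel $K(s,t)=\mathbb{E}_\omega[k(\omega,s,t)]$ continuous and positive definite. Let $X\subset\mathbb{R}^d$ be compact. Assume: (i) almost surely, $k(\omega,s,t)$ is $L_k$-Lipschitz in $s$, uniformly in $t$; (ii) $\rho$ is a Borel probability measure on $Z=\mathbb{R}^d\times\mathbb{R}\times\mathbb{R}$ supported on $S=\{(a,b,t)\in Z:\|a\|_2\le1,\ |b|\le1,\ |t|\le1\}$; (iii) $|k(\omega,s,t)|\le1$ almost surely. Let $c\in C(S)$, $f(x)=\int_S c(a,b,t)K(\langle a,x\rangle+b,t)\,d\rho(a,b,t)$, and $C=\|c\|_{L^\infty(S)}$. Draw $z_i=(a_i,b_i,t_i)$ i.i.d. with law $\rho$ and $\omega_i$ i.i.d. with law $\mathbb{P}$, independently, $i=1,\dots,N$, and set $$F_N(x)=\frac1N\sum_{i=1}^N c(z_i)\,k(\omega_i,\langle a_i,x\rangle+b_i,t_i).$$ Then for any $\delta\in(0,1)$ and $\epsilon>0$, with probability at least $1-\delta$ over the joint draw of $\{z_i,\omega_i\}_{i=1}^N$, $$\sup_{x\in X}|F_N(x)-f(x)|\le C\sqrt{\frac{2\log(2\mathcal{N}(\epsilon,X))+2\log(1/\delta)}{N}}+2CL_k\epsilon,$$ where $\mathcal{N}(\epsilon,X)$ is the $\epsilon$-covering number of $X$ in the Euclidean metric. *)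

(* Defs.v *)
From HB Require Import structures.
From mathcomp Require Import all_boot all_order all_algebra.
From mathcomp Require Import all_classical all_reals all_analysis.
Set Implicit Arguments. Unset Strict Implicit. Unset Printing Implicit Defensive.
Import Order.TTheory GRing.Theory Num.Theory.
Import numFieldNormedType.Exports.
Local Open Scope classical_set_scope.
Local Open Scope ring_scope.

Definition dotv (R : realType) (d : nat) (a x : 'rV[R]_d) : R :=
  \sum_(i < d) a 0 i * x 0 i.

Definition enorm (R : realType) (d : nat) (a : 'rV[R]_d) : R :=
  Num.sqrt (\sum_(i < d) a 0 i ^+ 2).

Definition Zt (R : realType) (d : nat) : Type := ('rV[R]_d * R * R)%type.

Definition Zmeas (R : realType) (d : nat) := g_sigma_algebraType (@open (Zt R d)).

Definition Sset (R : realType) (d : nat) : set (Zt R d) :=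
  [set z | enorm z.1.1 <= 1 /\ `|z.1.2| <= 1 /\ `|z.2| <= 1].

Definition has_cover (R : realType) (d : nat) (eps : R) (X : set 'rV[R]_d) (n : nat) :=
  exists y : 'I_n -> 'rV[R]_d, forall x, X x -> exists i : 'I_n, enorm (x - y i) <= eps.

Definition is_covering_number (R : realType) (d : nat) (eps : R) (X : set 'rV[R]_d)
    (M : nat) :=
  has_cover eps X M /\ forall n, has_cover eps X n -> (M <= n)%N.

Definition meanK (R : realType) (dO : measure_display) (O : measurableType dO)
    (P : probability O R) (k : O -> R -> R -> R) (s t : R) : R :=
  fine (\int[P]_w (k w s t)%:E)%E.

Definition pos_def_kernel (R : realType) (K : R -> R -> R) :=
  (forall s t, K s t = K t s) /\
  forall (n : nat) (x : 'I_n -> R) (c : 'I_n -> R),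
    0 <= \sum_(i < n) \sum_(j < n) c i * c j * K (x i) (x j).
Arguments Sset : clear implicits.

(* Main.v *)
(**
For fixed [x], [F_N(x)] is an average of i.i.d. terms of absolute value at most
[C] with mean [f(x)] (Fubini), so Hoeffding's inequality gives
[Q(|F_N(x) - f(x)| >= u) <= 2 exp(- N u^2 / (2 C^2))]; with
[u = C sqrt(2 ln(2 M / delta) / N)] the right-hand side is [delta / M].
A union bound controls the [M] centres of an optimal cover, and outside a null set
both [F_N] and [f] are [C L_k]-Lipschitz for the Euclidean norm, by Cauchy-Schwarz
and [|a| <= 1]; moving from [x] to the nearest centre costs [2 C L_k eps].

The moment generating function of the sum factorises because the law of a partial
sum together with the next draw is a product measure, which is determined by
its values on rectangles.
*)

Require Import Defs.
From HB Require Import structures.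
From mathcomp Require Import all_boot all_order all_algebra.
From mathcomp Require Import all_classical all_reals all_analysis.
From mathcomp Require Import measurable_realfun ring lra.
Import Order.TTheory GRing.Theory Num.Theory.
Import numFieldNormedType.Exports.
Local Open Scope classical_set_scope.
Local Open Scope ring_scope.

(** * Exponential inequalities behind Hoeffding's lemma *)

Lemma derive_ge0_le_from0 (R : realType) (f df : R -> R) (s : R) :
  (forall x, is_derive x (1 : R) f (df x)) -> (forall x, 0 <= x -> 0 <= df x) ->
  0 <= s -> f 0 <= f s.
Proof.
move=> fdf df0 s0.
have cf : {within `[0, s], continuous f}.
  apply: derivable_within_continuous => x _; exact: ex_derive.
have [x xs] := MVT_segment s0 (fun x _ => fdf x) cf.
rewrite subr0 => e; rewrite -subr_ge0 e mulr_ge0// df0//.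
by move: xs; rewrite in_itv/= => /andP[].
Qed.

(* The logarithmic derivative of [(1 + m) e^s + (1 - m) e^-s] starts at [m] and
   has slope at most [1]. *)
Lemma expR_mean_le (R : realType) (m s : R) : -1 <= m <= 1 -> 0 <= s ->
  (1 + m) * expR s + (1 - m) * expR (- s) <= 2 * expR (m * s + s ^+ 2 / 2).
Proof.
move=> m1 s0.
pose D (x : R) : R := (1 + m) * expR x + (1 - m) * expR (- x).
pose E (x : R) : R := (1 + m) * expR x - (1 - m) * expR (- x).
have D_gt0 x : 0 < D x.
  have := expR_gt0 x; have := expR_gt0 (- x); rewrite /D => h1 h2.
  have [m0|m0] := leP 0 m.
    by apply: ltr_wpDr; [apply: mulr_ge0; lra|apply: mulr_gt0; lra].
  by apply: ltr_wpDl; [apply: mulr_ge0; lra|apply: mulr_gt0; lra].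
have dD x : is_derive x (1 : R) D (E x).
  by apply: is_derive_eq; rewrite /E/= /GRing.scale/=; ring.
have dE x : is_derive x (1 : R) E (D x).
  by apply: is_derive_eq; rewrite /D/= /GRing.scale/=; ring.
have ED x : 0 <= x -> E x <= (m + x) * D x.
  (* Since [D' = E] and [E' = D], the quotient [E / D] has derivative [1 - (E / D)^2], so [g] has
     derivative [(E / D)^2]. It starts at [0] because [E 0 / D 0 = m]. *)
  move=> x0; pose g (y : R) : R := m + y - E y * (D y)^-1.
  have dg y : is_derive y (1 : R) g ((E y / D y) ^+ 2).
    have D0 : D y != 0 by rewrite gt_eqF.
    have dV := is_deriveV D0 (dD y).
    apply: is_derive_eq; rewrite /= /GRing.scale/=.
    by field.
  have := @derive_ge0_le_from0 _ _ _ _ dg (fun y _ => sqr_ge0 _) x0.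
  rewrite /g /D /E oppr0 expR0 !mulr1.
  rewrite -!/(D x) -!/(E x) -[leRHS]/(m + x - E x * (D x)^-1).
  rewrite [leLHS](_ : _ = 0); last first.
    by rewrite (_ : 1 + m + (1 - m) = 2); [field|lra].
  by rewrite subr_ge0 ler_pdivrMr.
(* The derivative of [G] is nonnegative by [ED], and [G 0 = -2]; comparing [G 0] with [G s] and
   clearing the exponential gives the claim. *)
pose G (x : R) : R := - (D x * expR (- (m * x + x ^+ 2 / 2))).
have dG x : is_derive x (1 : R) G
    (expR (- (m * x + x ^+ 2 / 2)) * ((m + x) * D x - E x)).
  by apply: is_derive_eq; rewrite /= /GRing.scale/=; field.
have := @derive_ge0_le_from0 _ _ _ _ dG _ s0.
rewrite /G mulr0 expr0n/= mul0r addr0 oppr0 expR0 mulr1 expRN lerN2.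
have -> : D 0 = 2 by rewrite /D oppr0 expR0; lra.
rewrite ler_pdivrMr ?expR_gt0//; apply.
by move=> x x0; rewrite mulr_ge0 ?expR_ge0// subr_ge0 ED.
Qed.

(** Convexity of the exponential: [r * y] is the mean of [r * C] and its opposite with weights
    [(1 + y / C) / 2] and [(1 - y / C) / 2]. *)
Lemma expR_chord_le (R : realType) (C r y : R) : 0 < C -> `|y| <= C ->
  expR (r * y) <= (1 + y / C) / 2 * expR (r * C) + (1 - y / C) / 2 * expR (- (r * C)).
Proof.
move=> C0 yC.
have [y1 y2] : -1 <= y / C /\ y / C <= 1.
  by move: yC; rewrite ler_norml ler_pdivlMr// ler_pdivrMr// mulN1r mul1r => /andP[].
have t01 : Itv.spec (@Itv.num_sem R) (Itv.Real `[0%Z, 1%Z]) ((1 + y / C) / 2).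
  rewrite /= /Itv.num_sem/= in_itv/= num_real/=; apply/andP; split; lra.
pose t : {i01 R} := Itv.mk t01.
have := convex_expR t (r * C) (- (r * C)).
rewrite !convRE/= /unstable.onem.
rewrite (_ : (1 + y / C) / 2 * (r * C) + _ = r * y); last by field; rewrite gt_eqF.
rewrite (_ : 1 - (1 + y / C) / 2 = (1 - y / C) / 2)//; first by field; rewrite gt_eqF.
Qed.

(** * Measurability and laws of independent pairs *)

Lemma measurable_preimage d1 d2 (T1 : measurableType d1) (T2 : measurableType d2)
    (f : T1 -> T2) (A : set T2) :
  measurable_fun setT f -> measurable A -> measurable (f @^-1` A).
Proof. by move=> mf mA; rewrite -[_ @^-1` _]setTI; exact: mf. Qed.

Lemma measurable_superlevel d (T : measurableType d) (R : realType) (g : T -> R)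
    (u : R) : measurable_fun setT g -> measurable [set t | u <= g t].
Proof.
move=> mg; have -> : [set t | u <= g t] = g @^-1` `[u, +oo[%classic.
  by apply/seteqP; split => x /=; rewrite in_itv/= andbT.
exact: measurable_preimage.
Qed.

Lemma measurable_expRM d (T : measurableType d) (R : realType) (r : R) (g : T -> R) :
  measurable_fun setT g -> measurable_fun setT (fun t => expR (r * g t)).
Proof.
move=> mg; apply: measurableT_comp => //.
exact: measurable_funM.
Qed.

(** A product measure is determined by its values on rectangles. The side event [G] lets a
    constraint on a partial sum be held fixed while the next draw is treated. *)
Lemma pair_law d d1 d2 (T : measurableType d) (S1 : measurableType d1)
    (S2 : measurableType d2) (R : realType) (Q : {measure set T -> \bar R})
    (m1 : probability S1 R) (m2 : probability S2 R) (X : T -> S1) (Y : T -> S2)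
    (G : set T) (q : R) :
  measurable_fun setT X -> measurable_fun setT Y -> measurable G -> 0 <= q ->
  (forall A B, measurable A -> measurable B ->
    Q (X @^-1` A `&` Y @^-1` B `&` G) = (m1 A * m2 B * q%:E)%E) ->
  forall E, measurable E ->
    Q ((fun t => (X t, Y t)) @^-1` E `&` G) = ((m1 \x m2) E * q%:E)%E.
Proof.
move=> mX mY mG q0 XY E mE.
have mXY : measurable_fun setT (fun t => (X t, Y t)).
  exact: measurable_fun_pair.
(* The main argument divides by [q]. If [q = 0], then [G] is null and both sides vanish. *)
move: q0; rewrite le_eqVlt => /predU1P[q0|q0].
  have QG : Q G = 0%E.
    by have := XY _ _ measurableT measurableT; rewrite -q0 mule0 !preimage_setT !setTI.
  rewrite -q0 mule0; apply/eqP; rewrite eq_le measure_ge0 andbT -QG.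
  by apply: le_measure; rewrite ?inE//; apply: measurableI => //; exact: measurable_preimage.
(* [nu] is the law of the pair under [Q] restricted to [G]; scaled by the inverse of [q], it agrees
   with the product of [m1] and [m2] on rectangles. *)
pose nu : {measure set (S1 * S2) -> \bar R} :=
  measure_function_pushforward__canonical__measure_function_Measure (mrestr Q mG) mXY.
have qV0 : 0 <= q^-1 by rewrite invr_ge0 ltW.
rewrite (@product_measure_unique _ _ _ _ _ m1 m2 (mscale (NngNum qV0) nu)) //=.
  rewrite /mscale/= /pushforward /mrestr/= muleAC -EFinM mulVf ?gt_eqF// mul1e.
  by [].
move=> A B mA mB.
rewrite /mscale/= /pushforward /mrestr/=.
transitivity ((q^-1)%:E * (m1 A * m2 B * q%:E))%E; first by rewrite -XY.
by rewrite muleC -muleA -EFinM mulfV ?gt_eqF// mule1.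
Qed.

Section product_probability.
Context d1 d2 (T1 : measurableType d1) (T2 : measurableType d2) (R : realType).
Variables (m1 : probability T1 R) (m2 : probability T2 R).

(** A named copy of the product measure, so that a probability structure can be attached to it. *)
Definition product_probability : set (T1 * T2) -> \bar R := (m1 \x m2)%E.

HB.instance Definition _ := Measure.on product_probability.

Let product_probability_setT : product_probability setT = 1%E.
Proof.
rewrite /product_probability -setXTT product_measure1E//.
by rewrite -[1%E]mule1; congr (_ * _)%E; exact: probability_setT.
Qed.

HB.instance Definition _ := Measure_isProbability.Build _ _ _
  product_probability product_probability_setT.

End product_probability.
Arguments product_probability {d1 d2 T1 T2 R}.

(** * The law of a sum of independent draws *)

Section sum_law.
Context d d1 d2 (T : measurableType d) (S1 : measurableType d1)
  (S2 : measurableType d2) (R : realType).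
Variables (Q : {measure set T -> \bar R}) (rho : probability S1 R)
  (P : probability S2 R) (z : nat -> T -> S1) (w : nat -> T -> S2).
Hypotheses (mz : forall i, measurable_fun setT (z i))
  (mw : forall i, measurable_fun setT (w i)).
Variables (h : S1 * S2 -> R) (mh : measurable_fun setT h).

Let S n t := \sum_(i < n) h (z i t, w i t).

Let mS n : measurable_fun setT (S n).
Proof.
apply: measurable_sum => i; apply: (measurableT_comp mh).
exact: measurable_fun_pair.
Qed.

(* Quantifying over the side event [G] lets the induction peel off the last
   draw as part of [G]. *)
Lemma iid_sum_law (r : R) n : exists m : probability R R,
  (\int[m]_u (expR (r * u))%:E = (\int[rho \x P]_p (expR (r * h p))%:E) ^+ n)%E /\
  forall G q, measurable G -> 0 <= q ->
  (forall A B, (forall i, measurable (A i)) -> (forall i, measurable (B i)) ->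
    Q ([set t | forall i, (i < n)%N -> A i (z i t) /\ B i (w i t)] `&` G)
      = (\prod_(i < n) (fine (rho (A i)) * fine (P (B i))) * q)%:E) ->
  forall D, measurable D -> Q (S n @^-1` D `&` G) = (m D * q%:E)%E.
Proof.
elim: n => [|n [m [mexp IH]]].
  exists (\d_(0 : R)); split.
    rewrite integral_dirac//=; first by rewrite diracT mul1e mulr0 expR0.
    exact/measurable_EFinP/measurable_expRM.
  move=> G q mG q0 + D mD => /(_ (fun=> setT) (fun=> setT)).
  rewrite big_ord0 mul1r (_ : [set _ | _] = setT) ?setTI; last first.
    by apply/seteqP; split.
  move=> QG; rewrite /S.
  have [D0|D0] := pselect (D 0).
    rewrite /= diracE mem_set// mul1e (_ : _ @^-1` D = setT) ?setTI ?QG//.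
    by apply/seteqP; split => // t _/=; rewrite big_ord0.
  rewrite /= diracE memNset// mul0e (_ : _ @^-1` D = set0) ?set0I ?measure0//.
  by apply/seteqP; split => // t /=; rewrite big_ord0.
(* The law for [n.+1] terms is the image of the product of [m] with the law of one draw under [phi],
   which adds the new term. The exponential of a sum then factorises by Tonelli. *)
pose mu := product_probability m (product_probability rho P).
pose phi (p : R * (S1 * S2)) : R := p.1 + h p.2.
have mphi : measurable_fun setT phi.
  by apply: measurable_funD => //; exact: measurableT_comp.
pose phim : {mfun _ >-> _} := mfun_Sub (mem_set mphi).
exists (distribution mu phim); split.
  rewrite expeS ge0_integral_distribution//=; last first.
    exact/measurable_EFinP/measurable_expRM.
  transitivity (\int[m \x product_probability rho P]_p
      (expR (r * (p.1 + h p.2)))%:E)%E; first by [].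
  rewrite fubini_tonelli1//; last exact/measurable_EFinP/measurable_expRM.
  rewrite /fubini_F -mexp.
  have inner u : (\int[product_probability rho P]_p (expR (r * (u + h p)))%:E =
      (expR (r * u))%:E * \int[rho \x P]_p (expR (r * h p))%:E)%E.
    rewrite -ge0_integralZl_EFin//; last exact/measurable_EFinP/measurable_expRM.
    by apply: eq_integral => p _; rewrite mulrDr expRD EFinM.
  under eq_integral => u _ do rewrite inner.
  rewrite ge0_integralZr//; last 2 first.
  - exact/measurable_EFinP/measurable_expRM.
  - exact: integral_ge0.
  by rewrite muleC.
move=> G q mG q0 AB D mD.
(* Draw [n] joins the side event, whose mass parameter becomes the probability of its rectangle
   times [q]. *)
have rect A B D' : measurable A -> measurable B -> measurable D' ->
    Q (S n @^-1` D' `&` (z n @^-1` A `&` w n @^-1` B `&` G)) =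
    (m D' * (fine (rho A) * fine (P B) * q)%:E)%E.
  move=> mA mB mD'; apply: IH => //.
  - by apply: measurableI => //; apply: measurableI; exact: measurable_preimage.
  - by rewrite !mulr_ge0 ?fine_ge0.
  move=> A' B' mA' mB'.
  pose A1 i := if (i < n)%N then A' i else A.
  pose B1 i := if (i < n)%N then B' i else B.
  have := AB A1 B1; rewrite big_ord_recr/= /A1 /B1 ltnn.
  under eq_bigr => i _ do rewrite ltn_ord.
  rewrite -!mulrA => <-.
  - congr (Q _); apply/seteqP; split => t /=.
    + move=> [H [[zA wB] Gt]]; split => // i; rewrite ltnS leq_eqVlt.
      by case/predU1P => [->|ni]; rewrite ?ltnn// ni; exact: H.
    + move=> [H Gt]; split; last first.
        by have := H n (leqnn _); rewrite ltnn => -[].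
      by move=> i ni; have := H i (leqW ni); rewrite ni.
  - by move=> i; case: ifP.
  - by move=> i; case: ifP.
have mzw : measurable_fun setT (fun t => (z n t, w n t)).
  exact: measurable_fun_pair.
(* [pair_law] is used twice: here, with the partial sum frozen, to replace rectangles for draw [n]
   by arbitrary events [E]; then below, to join the partial sum with that draw. *)
have step D' E : measurable D' -> measurable E ->
   Q (S n @^-1` D' `&` (fun t => (z n t, w n t)) @^-1` E `&` G) =
   (m D' * product_probability rho P E * q%:E)%E.
  move=> mD' mE; rewrite (setIC (S n @^-1` D')) -setIA.
  have q1 : 0 <= fine (m D') * q by rewrite mulr_ge0 ?fine_ge0.
  rewrite (@pair_law _ _ _ _ _ _ _ Q rho P (z n) (w n) _ _ _ _ _ q1)//.
  - rewrite EFinM fineK ?fin_num_measure//.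
    by rewrite muleA [in RHS](muleC (m D')).
  - apply: measurableI => //; exact: measurable_preimage.
  - move=> A B mA mB; have := rect _ _ _ mA mB mD'.
    rewrite setICA => ->; rewrite !EFinM !fineK ?fin_num_measure//.
    by rewrite muleCA.
have := @pair_law _ _ _ _ _ _ _ Q m (product_probability rho P) _ _ _ _ (mS n) mzw mG q0 step
  (phi @^-1` D).
rewrite /distribution /pushforward => <-; last exact: measurable_preimage.
congr (Q (_ `&` _)); apply/seteqP; split => t /=.
all: by rewrite /S big_ord_recr.
Qed.
End sum_law.

(** * Mean and moment generating function of a bounded variable *)

Section bounded_mgf.
Context d (T : measurableType d) (R : realType) (mu : probability T R).
Variables (h : T -> R) (C : R).
Hypotheses (mh : measurable_fun setT h) (hC : forall p, `|h p| <= C).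

Lemma bounded_integrable : mu.-integrable setT (EFin \o h).
Proof.
apply: measurable_bounded_integrable => //.
  by rewrite /= probability_setT ltry.
exists C; split; first exact: num_real.
by move=> x Cx p _; exact: le_trans (hC p) (ltW Cx).
Qed.

Lemma bounded_mean : `|fine (\int[mu]_p (h p)%:E)%E| <= C.
Proof.
have ih := bounded_integrable.
have fi : (\int[mu]_p (h p)%:E)%E \is a fin_num by exact: integrable_fin_num.
rewrite -lee_fin -abse_EFin fineK//.
apply: (le_trans (le_abse_integral _ _ _)) => //.
  by have /integrableP[] := ih.
apply: (@le_trans _ _ (\int[mu]_p (cst C%:E p))%E).
  apply: ge0_le_integral => //.
  - by apply: measurableT_comp => //; have /integrableP[] := ih.
  - by move=> p _; rewrite lee_fin.
by rewrite integral_cst//= probability_setT mule1.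
Qed.

(* Hoeffding's lemma: bound [expR] by its chord over [-C, C]. *)
Lemma bounded_mgf (r : R) : 0 < C -> 0 <= r ->
  (\int[mu]_p (expR (r * h p))%:E <=
   (expR (r * fine (\int[mu]_p (h p)%:E) + r ^+ 2 * C ^+ 2 / 2))%:E)%E.
Proof.
move=> C0 r0.
have ih := bounded_integrable.
have fi : (\int[mu]_p (h p)%:E)%E \is a fin_num by exact: integrable_fin_num.
set I := fine _.
(* Intercept and slope of the chord of [expR (r * y)] between [y = - C] and [y = C]. *)
pose a := (expR (r * C) + expR (- (r * C))) / 2.
pose b := (expR (r * C) - expR (- (r * C))) / (2 * C).
have C_neq0 : C != 0 by rewrite gt_eqF.
have chord p : expR (r * h p) <= a + b * h p.
  apply: (le_trans (expR_chord_le _ _ r _ C0 (hC p))).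
  by rewrite le_eqVlt; apply/orP; left; apply/eqP; rewrite /a /b; field.
apply: (@le_trans _ _ (\int[mu]_p (a%:E + b%:E * (h p)%:E))%E).
  apply: ge0_le_integral => //.
  - exact/measurable_EFinP/measurable_expRM.
  - apply/measurable_EFinP; apply: measurable_funD => //.
    exact: measurable_funM.
  - by move=> p _; rewrite -EFinM -EFinD lee_fin.
rewrite integralD//; last 2 first.
- exact: finite_measure_integrable_cst.
- exact: integrableZl.
rewrite integral_cst//= probability_setT mule1 integralZl//.
rewrite -(fineK fi) -/I -EFinM -EFinD lee_fin.
have m1 : -1 <= I / C <= 1.
  have := bounded_mean; rewrite -/I ler_norml => /andP[I1 I2].
  by rewrite ler_pdivlMr// ler_pdivrMr// mulN1r mul1r I1.
have := @expR_mean_le _ _ _ m1 (mulr_ge0 r0 (ltW C0)).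
rewrite (_ : I / C * (r * C) + _ = r * I + r ^+ 2 * C ^+ 2 / 2); last by field.
have -> : a + b * I =
    ((1 + I / C) * expR (r * C) + (1 - I / C) * expR (- (r * C))) / 2.
  by rewrite /a /b; field.
by rewrite ler_pdivrMr// [_ * 2]mulrC.
Qed.

End bounded_mgf.

(** * Hoeffding's inequality *)

Section hoeffding.
Context d d1 d2 (T : measurableType d) (S1 : measurableType d1)
  (S2 : measurableType d2) (R : realType).
Variables (Q : probability T R) (rho : probability S1 R) (P : probability S2 R)
  (z : nat -> T -> S1) (w : nat -> T -> S2) (n : nat).
Hypotheses (mz : forall i, measurable_fun setT (z i))
  (mw : forall i, measurable_fun setT (w i)).
Hypothesis iid : forall A B, (forall i, measurable (A i)) -> (forall i, measurable (B i)) ->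
    Q [set t | forall i, (i < n)%N -> A i (z i t) /\ B i (w i t)]
      = (\prod_(i < n) (fine (rho (A i)) * fine (P (B i))))%:E.
Hypothesis n_gt0 : (0 < n)%N.

(** Chernoff's bound for the law of the sum, whose moment generating function is the [n]-th power of
    that of a single term, controlled by [bounded_mgf]. *)
Lemma hoeffding_upper (h : S1 * S2 -> R) (C u : R) :
  measurable_fun setT h -> (forall p, `|h p| <= C) -> 0 < C -> 0 < u ->
  (Q [set t | (u <= n%:R^-1 * (\sum_(i < n) h (z i t, w i t))
                    - fine (\int[rho \x P]_p (h p)%:E)%E)%R] <=
   (expR (- (n%:R * u ^+ 2 / (2 * C ^+ 2))))%:E)%E.
Proof.
move=> mh hC C0 u0; set I := fine _.
have n0 : 0 < n%:R :> R by rewrite ltr0n.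
(* This [r] minimises [r^2 C^2 / 2 - r u], the exponent per draw left once the mean cancels; the
   minimum is [- u^2 / (2 C^2)]. *)
pose r := u / C ^+ 2.
have r0 : 0 < r by rewrite divr_gt0// exprn_gt0.
have [m [mexp law]] := @iid_sum_law _ _ _ _ _ _ _ Q rho P z w mz mw h mh r n.
pose a : R := n%:R * (I + u).
have -> : Q [set t | (u <= n%:R^-1 * (\sum_(i < n) h (z i t, w i t)) - I)%R] =
    m [set x | a <= x].
  have := law setT 1 measurableT ler01 _ [set x | a <= x].
  rewrite mule1 setIT => <-.
  - congr (Q _); apply/seteqP; split => t /=.
    + by rewrite /a lerBrDr mulrC ler_pdivlMr// mulrC addrC.
    + by rewrite /a lerBrDr [X in _ -> _ <= X]mulrC ler_pdivlMr// mulrC [u + I]addrC.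
  - by move=> A B mA mB; rewrite setIT mulr1; exact: iid.
  - exact: measurable_superlevel.
pose X : {RV m >-> R} := mfun_Sub (mem_set (@measurable_id _ R setT)).
have := chernoff X a r0; rewrite /= => /le_trans; apply.
rewrite /mmt_gen_fun unlock /=.
have -> : (\int[m]_x (expR (x * r))%:E = \int[m]_x (expR (r * x))%:E)%E.
  by apply: eq_integral => x _; rewrite mulrC.
rewrite mexp.
have M := @bounded_mgf _ _ _ (product_probability rho P) h C mh hC r C0 (ltW r0).
have M0 : (0 <= \int[rho \x P]_p (expR (r * h p))%:E)%E by exact: integral_ge0.
apply: (@le_trans _ _ ((expR (r * I + r ^+ 2 * C ^+ 2 / 2))%:E ^+ n
    * (expR (- (r * a)))%:E)%E).
  apply: lee_wpmul2r; first by rewrite lee_fin expR_ge0.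
  elim: (n) => [|j IHj]; first by rewrite !expe0.
  by rewrite !expeS lee_pmul// expe_ge0.
rewrite -EFin_expe -EFinM lee_fin -expRM_natl -expRD ler_expR /a /r.
rewrite le_eqVlt; apply/orP; left; apply/eqP; field.
by rewrite gt_eqF.
Qed.

Lemma hoeffding (h : S1 * S2 -> R) (C u : R) :
  measurable_fun setT h -> (forall p, `|h p| <= C) -> 0 < C -> 0 < u ->
  (Q [set t | (u <= `|n%:R^-1 * (\sum_(i < n) h (z i t, w i t))
                    - fine (\int[rho \x P]_p (h p)%:E)%E|)%R] <=
   (2 * expR (- (n%:R * u ^+ 2 / (2 * C ^+ 2))))%:E)%E.
Proof.
move=> mh hC C0 u0.
pose S t := n%:R^-1 * \sum_(i < n) h (z i t, w i t).
have mS : measurable_fun setT S.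
  apply: measurable_funM => //; apply: measurable_sum => i.
  by apply: (measurableT_comp mh); exact: measurable_fun_pair.
have ih := @bounded_integrable _ _ _ (product_probability rho P) _ _ mh hC.
have fi : (\int[rho \x P]_p (h p)%:E)%E \is a fin_num by exact: integrable_fin_num.
have up := @hoeffding_upper h C u mh hC C0 u0.
have := @hoeffding_upper (fun p => - h p) C u (measurable_funN mh) _ C0 u0.
set I := fine _ in up *.
have -> : fine (\int[rho \x P]_p (- h p)%:E)%E = - I.
  by under eq_integral do rewrite EFinN; rewrite integralN ?fineN//; exact: integrable_add_def.
have -> : [set t | (u <= n%:R^-1 * (\sum_(i < n) - h (z i t, w i t)) - - I)%R]
   = [set t | (u <= - (S t - I))%R].
  by apply/seteqP; split => t /=; rewrite sumrN mulrN opprB opprK addrC.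
move=> dn.
have -> : [set t | (u <= `|S t - I|)%R] =
    [set t | (u <= S t - I)%R] `|` [set t | (u <= - (S t - I))%R].
  by apply/seteqP; split => t /=; rewrite lerNr ler_normr lerNr => /orP.
apply: (le_trans (measureU2 _ _ _)).
- by apply: measurable_superlevel; apply: measurable_funB.
- by apply: measurable_superlevel; apply: measurableT_comp => //; apply: measurable_funB.
rewrite mulr_natl mulr2n EFinD; apply: leeD; first exact: up.
by apply: dn => p; rewrite normrN.
Qed.

End hoeffding.

(** * Euclidean geometry and the topology of the parameter set *)

Lemma dotv_cauchy_schwarz (R : realType) d (a x : 'rV[R]_d) :
  `|dotv a x| <= enorm a * enorm x.
Proof.
have sq0 (v : 'rV[R]_d) : 0 <= \sum_(i < d) v 0 i ^+ 2.
  by apply: sumr_ge0 => i _; exact: sqr_ge0.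
rewrite /enorm -sqrtrM// -sqrtr_sqr ler_sqrt ?mulr_ge0//.
(* Lagrange's identity: this sum of squares is twice the gap in the squared Cauchy-Schwarz
   inequality. *)
have : 0 <= \sum_(i < d) \sum_(j < d) (a 0 i * x 0 j - a 0 j * x 0 i) ^+ 2.
  by apply: sumr_ge0 => i _; apply: sumr_ge0 => j _; exact: sqr_ge0.
have -> : \sum_(i < d) \sum_(j < d) (a 0 i * x 0 j - a 0 j * x 0 i) ^+ 2 =
    2 * ((\sum_(i < d) a 0 i ^+ 2) * (\sum_(i < d) x 0 i ^+ 2) - dotv a x ^+ 2).
  set A := \sum_(i < d) a 0 i ^+ 2; set B := \sum_(i < d) x 0 i ^+ 2.
  transitivity (\sum_(i < d) (a 0 i ^+ 2 * B + a 0 i * x 0 i * (- 2 * dotv a x)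
      + x 0 i ^+ 2 * A)).
    apply: eq_bigr => i _.
    transitivity (\sum_(j < d) (a 0 i ^+ 2 * x 0 j ^+ 2
      + - 2 * (a 0 i * x 0 i) * (a 0 j * x 0 j) + x 0 i ^+ 2 * a 0 j ^+ 2)).
      by apply: eq_bigr => j _; ring.
    by rewrite !big_split/= -!mulr_sumr -/A -/B -/(dotv a x); ring.
  by rewrite !big_split/= -!mulr_suml -/A -/B -/(dotv a x); ring.
by rewrite pmulr_rge0// subr_ge0.
Qed.

Lemma dotvBr (R : realType) d (a x y : 'rV[R]_d) :
  dotv a x - dotv a y = dotv a (x - y).
Proof.
rewrite /dotv -sumrB; apply: eq_bigr => i _.
by rewrite !mxE mulrBr.
Qed.

(** Stated relative to a closed set because [c] is continuous only on [S]. The preimage of an open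
    interval in [D] is the trace on [D] of an open [V], and [D] is Borel. *)
Lemma within_continuous_measurable_borel (R : realType) d
    (D : set (Zt R d)) (f : Zt R d -> R) : closed D -> {within D, continuous f} ->
  measurable_fun (D : set (Zmeas R d)) f.
Proof.
move=> cD /continuousP cf.
apply: (measurability _ (RGenOpens.measurableE R)).
move=> _ [_ [a [b ->] <-]].
have /open_subspaceP[V oV VD] := cf _ (@interval_open _ (BRight a) (BLeft b) isT isT).
rewrite setIC -VD; apply: measurableI; first exact: sub_sigma_algebra.
rewrite -(setCK D); apply: measurableC; apply: sub_sigma_algebra.
exact: closed_openC.
Qed.

Section geometry.
Context (R : realType) (d : nat).

Lemma continuous_coord (i : 'I_d) : continuous (fun z : Zt R d => z.1.1 0 i).
Proof.
move=> z; apply: (@continuous_comp _ _ _ (fun z : Zt R d => z.1.1) (fun a => a 0 i)).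
  by apply: continuous_comp; exact: cvg_fst.
exact: coord_continuous.
Qed.

Lemma continuous_offset : continuous (fun z : Zt R d => z.1.2).
Proof.
move=> z; apply: (@continuous_comp _ _ _ (fun z : Zt R d => z.1) (fun a => a.2)).
  exact: cvg_fst.
exact: cvg_snd.
Qed.

Lemma continuous_affine (x : 'rV[R]_d) :
  continuous (fun z : Zt R d => dotv z.1.1 x + z.1.2).
Proof.
move=> z; apply: cvgD; last exact: continuous_offset.
apply: cvg_big => [|i _]; first exact: add_continuous.
  apply: cvgM; [exact: continuous_coord|exact: cvg_cst].
Qed.

Lemma continuous_enorm : continuous (fun z : Zt R d => enorm z.1.1).
Proof.
move=> z; apply: (@continuous_comp _ _ _
  (fun z : Zt R d => \sum_(i < d) z.1.1 0 i ^+ 2) Num.sqrt).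
  apply: cvg_big => [|i _]; first exact: add_continuous.
  apply: (@continuous_comp _ _ _ (fun z : Zt R d => z.1.1 0 i) (fun y => y ^+ 2)).
    exact: continuous_coord.
  exact: exprn_continuous.
exact: sqrt_continuous.
Qed.

Lemma closed_Sset : closed (Sset R d).
Proof.
have cl (g : Zt R d -> R) : continuous g -> closed [set z | g z <= 1].
  by move=> cg; exact: (@preimage_closed _ _ g [set y | y <= 1]).
have -> : Sset R d = [set z | enorm z.1.1 <= 1] `&`
    ([set z | `|z.1.2| <= 1] `&` [set z | `|z.2| <= 1]) by [].
apply: closedI; first exact/cl/continuous_enorm.
apply: closedI; apply: cl => z.
  by apply: cvg_norm; exact: continuous_offset.
by apply: cvg_norm; exact: cvg_snd.
Qed.

Lemma measurable_Sset : measurable (Sset R d : set (Zmeas R d)).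
Proof.
rewrite -(setCK (Sset R d)); apply: measurableC; apply: sub_sigma_algebra.
exact/closed_openC/closed_Sset.
Qed.

Lemma compact_Sset : compact (Sset R d).
Proof.
pose I : set R := `[-1, 1]%classic.
have cI : compact I by exact: segment_compact.
pose K : set (Zt R d) := ([set v : 'rV[R]_d | forall i, I (v 0 i)] `*` I) `*` I.
have cK : compact K.
  by apply: compact_setX => //; apply: compact_setX => //; exact: (@rV_compact R d (fun=> I)).
apply: (subclosed_compact closed_Sset cK) => -[[a b] t] [/= a1 [b1 t1]].
have IE (y : R) : `|y| <= 1 -> I y by rewrite /I/= in_itv/= ler_norml.
split; [split|] => /=; [|exact: IE..].
move=> i; apply: IE; apply: le_trans a1; rewrite -sqrtr_sqr ler_sqrt.
  by rewrite (bigD1 i)//= lerDl; apply: sumr_ge0 => j _; exact: sqr_ge0.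
by apply: sumr_ge0 => j _; exact: sqr_ge0.
Qed.

(** A real [sup] bounds its set only if that set is bounded above; compactness of [S] provides
    this. *)
Lemma Sset_sup_ge (c : Zt R d -> R) z : {within Sset R d, continuous c} ->
  Sset R d z -> `|c z| <= sup [set `|c z| | z in Sset R d].
Proof.
move=> cc Sz; apply: sup_upper_bound; last by exists z.
split; first by exists `|c z|, z.
have /compact_bounded[M [_ Mc]] := continuous_compact cc compact_Sset.
exists (M + 1) => _ [y Sy <-]; apply: Mc; first by rewrite ltrDl.
by exists y.
Qed.

End geometry.

(** * Truncated random features and their mean *)

Section random_features.
Context (R : realType) (d : nat) (dO : measure_display) (O : measurableType dO).
Variables (P : probability O R) (k : O -> R -> R -> R)
  (rho : probability (Zmeas R d) R) (c : Zt R d -> R) (B : set O) (C Lk : R).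
Hypotheses
  (mk : measurable_fun setT (fun p : O * R * R => k p.1.1 p.1.2 p.2))
  (mB : measurable B) (PB : P B = 0%E)
  (k_lip : forall w, ~ B w ->
    forall s s' t : R, `|k w s t - k w s' t| <= Lk * `|s - s'|)
  (k_bdd : forall w, ~ B w -> forall s t : R, `|k w s t| <= 1)
  (c_cont : {within Sset R d, continuous c})
  (c_bdd : forall z, Sset R d z -> `|c z| <= C)
  (C_ge0 : 0 <= C) (Lk_ge0 : 0 <= Lk).

Let S : set (Zmeas R d) := Sset R d.

Let cS : Zmeas R d -> R := (c : Zmeas R d -> R) \_ S.

Let kB (w : O) s t : R := \1_(~` B) w * k w s t.

(* Cutting off to [S] in [z] and to [~` B] in [w], where [B] is a null set
   containing the exceptional outcomes, makes the boundedness and Lipschitz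
   assumptions hold everywhere without changing the mean. *)
Definition feature (x : 'rV[R]_d) (p : Zmeas R d * O) : R :=
  cS p.1 * kB p.2 (dotv p.1.1.1 x + p.1.1.2) p.1.2.

Lemma featureE x z w : Sset R d z -> ~ B w ->
  feature x (z, w) = c z * k w (dotv z.1.1 x + z.1.2) z.2.
Proof.
move=> Sz Bw; rewrite /feature /cS /kB/= patchE mem_set// indicE mem_set//.
by rewrite mul1r.
Qed.

Let cS_bdd z : `|cS z| <= C.
Proof.
rewrite /cS patchE; case: ifPn => [|_]; last by rewrite normr0.
by move/set_mem; exact: c_bdd.
Qed.

Let kB_bdd w s t : `|kB w s t| <= 1.
Proof.
rewrite /kB indicE; have [Bw|Bw] := boolP (w \in ~` B).
  by rewrite mul1r k_bdd//; exact: set_mem Bw.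
by rewrite mul0r normr0.
Qed.

Let kB_lip w s s' t : `|kB w s t - kB w s' t| <= Lk * `|s - s'|.
Proof.
rewrite /kB indicE; have [Bw|Bw] := boolP (w \in ~` B).
  by rewrite !mul1r k_lip//; exact: set_mem Bw.
by rewrite !mul0r subrr normr0 mulr_ge0.
Qed.

Lemma feature_bdd x p : `|feature x p| <= C.
Proof.
by rewrite /feature normrM -[leRHS]mulr1 ler_pM.
Qed.

(** Off [S] both features vanish. On [S], the first kernel arguments differ by the inner product of
    [a] with [x - y], at most [enorm (x - y)] in size since [enorm a <= 1]. *)
Lemma feature_lip x y p :
  `|feature x p - feature y p| <= C * (Lk * enorm (x - y)).
Proof.
rewrite /feature -mulrBr normrM; have [Sz|nSz] := pselect (S p.1); last first.
  by rewrite /cS patchE memNset// normr0 mul0r !mulr_ge0// sqrtr_ge0.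
apply: ler_pM => //; apply: (le_trans (kB_lip _ _ _ _)).
apply: ler_wpM2l => //.
rewrite opprD addrACA subrr addr0 dotvBr.
apply: (le_trans (dotv_cauchy_schwarz _ _ _ _)).
by rewrite ler_piMl ?sqrtr_ge0//; case: Sz.
Qed.

Let maffine x : measurable_fun setT (fun z : Zmeas R d => dotv z.1.1 x + z.1.2).
Proof.
apply: within_continuous_measurable_borel; first exact: closedT.
by apply: continuous_subspaceT; exact: continuous_affine.
Qed.

Let mlast : measurable_fun setT (fun z : Zmeas R d => z.2).
Proof.
apply: within_continuous_measurable_borel; first exact: closedT.
by apply: continuous_subspaceT => z; exact: cvg_snd.
Qed.

Lemma measurable_feature x : measurable_fun setT (feature x).
Proof.
apply: measurable_funM.
  apply: (@measurableT_comp _ _ _ _ _ _ cS) => //.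
  apply: (iffLR (@measurable_restrictT _ _ _ _ S c (measurable_Sset R d))).
  exact: (within_continuous_measurable_borel _ _ _ _ (closed_Sset R d) c_cont).
apply: measurable_funM.
  apply: (@measurableT_comp _ _ _ _ _ _ (\1_(~` B) : O -> R) _ snd) => //.
  exact: measurable_indic (measurableC mB).
apply: (measurableT_comp mk (g := fun p : Zmeas R d * O =>
  ((p.2, dotv p.1.1.1 x + p.1.1.2), p.1.2))).
apply: measurable_fun_pair; first apply: measurable_fun_pair => //.
- exact: (measurableT_comp (maffine x)).
- exact: (measurableT_comp mlast).
Qed.

Let mk1 s t : measurable_fun setT (fun w => k w s t).
Proof.
apply: (measurableT_comp mk (g := fun w : O => ((w, s), t))).
by apply: measurable_fun_pair => //; exact: measurable_fun_pair.
Qed.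

Let mkB1 s t : measurable_fun setT (fun w => kB w s t).
Proof.
by apply: measurable_funM => //; exact: measurable_indic (measurableC mB).
Qed.

Let integral_kB s t : (\int[P]_w (kB w s t)%:E = (meanK P k s t)%:E)%E.
Proof.
have e : (\int[P]_w (kB w s t)%:E = \int[P]_w (k w s t)%:E)%E.
  apply: ae_eq_integral => //; [exact/measurable_EFinP..|].
  exists B; split => // w /= nk; apply: contrapT => Bw; apply: nk => _.
  by rewrite /kB indicE mem_set// mul1r.
rewrite /meanK -e fineK//.
apply: integrable_fin_num => //.
exact: (@bounded_integrable _ _ _ P (fun w => kB w s t) 1).
Qed.

(** Fubini: the inner integral over [w] turns [kB] into the mean kernel, as [B] is null, and the
    cut-off in [cS] restricts the outer integral to [S]. *)
Lemma feature_mean x : fine (\int[rho \x P]_p (feature x p)%:E)%E =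
  fine (\int[rho]_(z in (Sset R d : set (Zmeas R d)))
          (c z * meanK P k (dotv z.1.1 x + z.1.2) z.2)%:E)%E.
Proof.
have ih := @bounded_integrable _ _ _ (product_probability rho P) _ _
  (measurable_feature x) (feature_bdd x).
rewrite -(integral12_prod_meas1 ih) [in RHS]integral_mkcond; congr fine.
apply: eq_integral => z _; rewrite /fubini_F/= patchE.
under eq_integral => w _ do rewrite /feature/= EFinM.
rewrite integralZl//; last first.
  exact: (@bounded_integrable _ _ _ P (fun w => kB w _ _) 1).
rewrite integral_kB -EFinM /cS patchE; case: ifP => // _.
by rewrite mul0r.
Qed.

Lemma feature_mean_lip x y :
  `|fine (\int[rho \x P]_p (feature x p)%:E)%E
    - fine (\int[rho \x P]_p (feature y p)%:E)%E| <= C * (Lk * enorm (x - y)).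
Proof.
have ih u := @bounded_integrable _ _ _ (product_probability rho P) _ _
  (measurable_feature u) (feature_bdd u).
rewrite -fineB; last 2 first.
- exact: (integrable_fin_num measurableT (ih x)).
- exact: (integrable_fin_num measurableT (ih y)).
rewrite -(integralB measurableT (ih x) (ih y)).
apply: (@bounded_mean _ _ _ (product_probability rho P)
  (fun p => feature x p - feature y p)); last exact: feature_lip.
by apply: measurable_funB; exact: measurable_feature.
Qed.

End random_features.

(** * Union bound and the uniform estimate *)

Lemma measure_bigsetU_ord_le d (T : measurableType d) (R : realType) (mu : {measure set T -> \bar R})
    (n : nat) (F : 'I_n -> set T) (e : R) : (forall i, measurable (F i)) ->
  (forall i, (mu (F i) <= e%:E)%E) ->
  (mu (\big[setU/set0]_(i < n) F i) <= (n%:R * e)%:E)%E.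
Proof.
move=> mF Fe.
apply: (@le_trans _ _ (\sum_(i < n) mu (F i))%E).
  elim: (index_enum _) => [|i r IHr]; first by rewrite !big_nil measure0.
  rewrite !big_cons; apply: (le_trans (measureU2 _ _ _)) => //.
    exact: bigsetU_measurable.
  exact: leeD2l.
apply: (le_trans (lee_sum _ (fun i _ => Fe i))).
by rewrite sumEFin sumr_const card_ord lee_fin mulr_natl.
Qed.

Theorem theorem11 (R : realType) (d : nat)
  (* probability space (Omega, A, P) and the random kernel k *)
  (dO : measure_display) (O : measurableType dO) (P : probability O R)
  (k : O -> R -> R -> R)
  (hk_meas : measurable_fun setT (fun p : O * R * R => k p.1.1 p.1.2 p.2))
  (hK_cont : continuous (fun p : R * R => meanK P k p.1 p.2))
  (hK_pd : pos_def_kernel (meanK P k))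
  (* compact domain *)
  (X : set 'rV[R]_d) (hX : compact X)
  (* (i) a.s. L_k-Lipschitz in s, uniformly in t *)
  (Lk : R)
  (hLip : {ae P, forall w, forall s s' t : R, `|k w s t - k w s' t| <= Lk * `|s - s'|})
  (* (ii) Borel probability measure rho on Z supported on S *)
  (rho : probability (Zmeas R d) R)
  (hsupp : rho (~` (Sset R d : set (Zmeas R d))) = 0%E)
  (* (iii) |k| <= 1 a.s. *)
  (hbdd : {ae P, forall w, forall s t : R, `|k w s t| <= 1})
  (* c in C(S), C = ||c||_{L^oo(S)} *)
  (c : Zt R d -> R) (hc : {within Sset R d, continuous c})
  (C : R) (hC : C = sup [set `|c z| | z in Sset R d])
  (f : 'rV[R]_d -> R)
  (hf : forall x, f x = fine (\int[rho]_(z in (Sset R d : set (Zmeas R d)))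
          (c z * meanK P k (dotv z.1.1 x + z.1.2) z.2)%:E)%E)
  (* N i.i.d. draws z_i ~ rho, omega_i ~ P, all independent, on a probability space T *)
  (N : nat) (hN : (0 < N)%N)
  (dT : measure_display) (T : measurableType dT) (Q : probability T R)
  (zs : 'I_N -> T -> Zmeas R d) (ws : 'I_N -> T -> O)
  (hzs : forall i, measurable_fun setT (zs i))
  (hws : forall i, measurable_fun setT (ws i))
  (hiid : forall (A : 'I_N -> set (Zmeas R d)) (B : 'I_N -> set O),
     (forall i, measurable (A i)) -> (forall i, measurable (B i)) ->
     fine (Q (\bigcap_(i in [set: 'I_N]) (zs i @^-1` A i `&` ws i @^-1` B i)))
       = \prod_(i < N) (fine (rho (A i)) * fine (P (B i))))
  (FN : T -> 'rV[R]_d -> R)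
  (hFN : forall th x, FN th x = N%:R^-1 * \sum_(i < N)
          c (zs i th) * k (ws i th) (dotv (zs i th).1.1 x + (zs i th).1.2) (zs i th).2)
  (* covering number *)
  (eps : R) (heps : 0 < eps) (M : nat) (hM : is_covering_number eps X M)
  (delta : R) (hdelta : 0 < delta < 1) :
  exists E : set T, measurable E /\
    E `<=` [set th | forall x, X x ->
       `|FN th x - f x| <=
         C * Num.sqrt ((2 * ln (2 * M%:R) + 2 * ln (delta^-1)) / N%:R)
         + 2 * C * Lk * eps] /\
    ((1 - delta)%:E <= Q E)%E.
Proof.
have C_bdd z : Sset R d z -> `|c z| <= C by rewrite hC; exact: Sset_sup_ge.
have S0 : Sset R d 0.
  rewrite /Sset/= normr0 ler01; split=> //.
  rewrite /enorm big1 ?sqrtr0// => i _; by rewrite mxE expr0n.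
have C_ge0 : 0 <= C by exact: le_trans (C_bdd _ S0).
have [B [mB PB subB]] := filterI hLip hbdd.
have kB w : ~ B w -> (forall s s' t : R, `|k w s t - k w s' t| <= Lk * `|s - s'|) /\
    (forall s t : R, `|k w s t| <= 1).
  by move=> Bw; apply: contrapT => nk; apply: Bw; exact: subB.
have k_lip w (Bw : ~ B w) := (kB w Bw).1.
have k_bdd w (Bw : ~ B w) := (kB w Bw).2.
(* A null set cannot be the whole space, so some outcome lies outside [B]; its Lipschitz bound
   between [1] and [0] forces the sign. *)
have Lk_ge0 : 0 <= Lk.
  have [w Bw] : exists w, ~ B w.
    apply: contrapT => /forallNP allB.
    have BT : B = setT by apply/seteqP; split => // w _; apply: contrapT; exact: allB.
    by move: PB; rewrite BT /= probability_setT => /eqP; rewrite onee_eq0.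
  have := k_lip _ Bw 1 0 0; rewrite subr0 normr1 mulr1; exact: le_trans.
pose S : set (Zmeas R d) := Sset R d.
have mS : measurable S by exact: measurable_Sset.
pose h := feature R d _ O k c B.
have mh x : measurable_fun setT (h x) by exact: measurable_feature.
have h_bdd x p : `|h x p| <= C by exact: feature_bdd.
have h_lip x y p : `|h x p - h y p| <= C * (Lk * enorm (x - y)).
  exact: feature_lip.
have fE x : f x = fine (\int[rho \x P]_p (h x p)%:E)%E.
  by rewrite hf (feature_mean _ _ _ _ _ _ _ _ _ C).
have f_lip x y : `|f x - f y| <= C * (Lk * enorm (x - y)).
  by rewrite !fE; exact: feature_mean_lip.
have [hcov _] := hM.
(* A cover by no points means that [X] is empty, and the full event works. *)
case: M hM hcov => [_ [y ycov]|M0 _ [y ycov]].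
  exists setT; split => //; split; last first.
    by rewrite /= probability_setT lee_fin; lra.
  by move=> t _ x /ycov[[]].
set M1 := M0.+1 in y ycov *.
set u := C * Num.sqrt _.
pose F t x := N%:R^-1 * \sum_(i < N) h x (zs i t, ws i t).
have N0 : 0 < N%:R :> R by rewrite ltr0n.
have F_lip t x x' : `|F t x - F t x'| <= C * (Lk * enorm (x - x')).
  rewrite /F -mulrBr -sumrB normrM gtr0_norm ?invr_gt0// ler_pdivrMl//.
  apply: (le_trans (ler_norm_sum _ _ _)).
  apply: (le_trans (ler_sum _ (fun i _ => h_lip x x' _))).
  by rewrite sumr_const card_ord mulr_natl.
have mF x : measurable_fun setT (fun t => F t x).
  apply: measurable_funM => //; apply: measurable_sum => i.
  by apply: (measurableT_comp (mh x)); exact: measurable_fun_pair.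
(* The inequality is strict so that [bad j] is empty in the degenerate case [C = 0], where
   [u = 0]. *)
pose bad j := [set t | u < `|F t (y j) - f (y j)|].
have mbad j : measurable (bad j).
  have -> : bad j = (fun t => `|F t (y j) - f (y j)|) @^-1` `]u, +oo[%classic.
    by apply/seteqP; split => t /=; rewrite in_itv/= andbT.
  apply: measurable_preimage => //; apply: measurableT_comp => //.
  exact: measurable_funB.
have [delta0 delta1] := andP hdelta.
have M_gt0 : 0 < M1%:R :> R by rewrite ltr0n.
(* With this [L], [u] is [C] times the root of [2 L / N], so Hoeffding's exponent is exactly
   [- L]. *)
pose L := ln (2 * M1%:R) + ln delta^-1.
have expL : expR (- L) = delta / (2 * M1%:R).
  rewrite /L lnV ?posrE// opprD opprK expRD expRN !lnK ?posrE ?mulr_gt0//.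
  by rewrite mulrC.
have L_gt0 : 0 < L.
  rewrite -oppr_lt0 -expR_lt1 expL ltr_pdivrMr ?mulr_gt0// mul1r.
  apply: (lt_le_trans delta1); apply: (@le_trans _ _ (2 * 1)); first by lra.
  by rewrite ler_pM2l// ler1n.
(* Extends the finite family of draws to the sequences that [hoeffding] takes; indices beyond [N]
   fall back to draw [0]. *)
pose idx (i : nat) : 'I_N := insubd (Ordinal hN) i.
have idxK (i : 'I_N) : idx i = i by exact: valKd.
have iid A B' : (forall i, measurable (A i)) -> (forall i, measurable (B' i)) ->
    Q [set t | forall i, (i < N)%N -> A i (zs (idx i) t) /\ B' i (ws (idx i) t)] =
    (\prod_(i < N) (fine (rho (A i)) * fine (P (B' i))))%:E.
  move=> mA mB'.
  rewrite -(hiid (fun i => A i) (fun i => B' i))//.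
  rewrite fineK; last first.
    apply: fin_num_measure; apply: fin_bigcap_measurable => //.
    by move=> i _; apply: measurableI; exact: measurable_preimage.
  congr (Q _); apply/seteqP; split => t /= H.
    by move=> i _ /=; have := H i (ltn_ord i); rewrite idxK.
  by move=> i iN; rewrite [idx i](idxK (Ordinal iN)); exact: H (Ordinal iN) I.
have Qbad j : (Q (bad j) <= (delta / M1%:R)%:E)%E.
  have [C0|C_neq0] := eqVneq C 0.
    have h0 x p : h x p = 0.
      by apply/eqP; rewrite -normr_le0 -C0.
    rewrite (_ : bad j = set0) ?measure0 ?lee_fin ?divr_ge0 ?ltW//.
    apply/seteqP; split => // t; rewrite /bad /u C0 mul0r /=.
    rewrite fE /F big1// integral0_eq ?subrr ?mulr0 ?subrr ?normr0 ?ltxx//.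
    by move=> p _; rewrite h0.
  have C_gt0 : 0 < C by rewrite lt_neqAle eq_sym C_neq0.
  have uE : u = C * Num.sqrt (2 * L / N%:R) by rewrite /u -mulrDr.
  have u_gt0 : 0 < u by rewrite uE mulr_gt0// sqrtr_gt0 divr_gt0// mulr_gt0.
  have := hoeffding _ _ _ _ _ _ _ Q rho P _ _ N (fun i => hzs (idx i))
    (fun i => hws (idx i)) iid hN (h (y j)) C u (mh _) (h_bdd _) C_gt0 u_gt0.
  rewrite (_ : N%:R * u ^+ 2 / (2 * C ^+ 2) = L); last first.
    rewrite uE exprMn sqr_sqrtr; first by field; rewrite C_neq0 gt_eqF.
    by rewrite ltW// divr_gt0// mulr_gt0.
  rewrite expL (_ : 2 * (delta / (2 * M1%:R)) = delta / M1%:R); last first.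
    by field; rewrite gt_eqF.
  apply: le_trans; apply: le_measure; rewrite ?inE//.
    apply: measurable_superlevel; apply: measurableT_comp => //.
    apply: measurable_funB => //; apply: measurable_funM => //.
    apply: measurable_sum => i; apply: (measurableT_comp (mh _)).
    exact: measurable_fun_pair.
  move=> t; rewrite /bad /F /= fE => /ltW.
  by under [in X in _ -> X]eq_bigr do rewrite idxK.
(* Outside this event every draw satisfies the cut-offs, so [F] coincides with [FN]. *)
pose null := \big[setU/set0]_(i < N) (zs i @^-1` (~` S) `|` ws i @^-1` B).
have mz0 i : measurable (zs i @^-1` (~` S)).
  by apply: measurable_preimage => //; exact: measurableC.
have mw0 i : measurable (ws i @^-1` B) by exact: measurable_preimage.
have mnull : measurable null.
  by apply: bigsetU_measurable => i _; exact: measurableU.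
(* Leaving the other draws unconstrained in [hiid] makes the product vanish through its [i]-th
   factor. *)
have rect0 A B' i : measurable A -> measurable B' -> rho A = 0%E \/ P B' = 0%E ->
    Q (zs i @^-1` A `&` ws i @^-1` B') = 0%E.
  move=> mA mB' AB0.
  pose A1 j := if j == i then A else setT.
  pose B1 j := if j == i then B' else setT.
  have mA1 j : measurable (A1 j) by rewrite /A1; case: ifP.
  have mB1 j : measurable (B1 j) by rewrite /B1; case: ifP.
  have := hiid A1 B1 mA1 mB1.
  rewrite (bigD1 i)//= (_ : fine (rho (A1 i)) * fine (P (B1 i)) = 0); last first.
    by rewrite /A1 /B1 eqxx; case: AB0 => ->; rewrite ?mul0r ?mulr0.
  rewrite mul0r => Q0.
  have -> : zs i @^-1` A `&` ws i @^-1` B' =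
      \bigcap_(j in [set: 'I_N]) (zs j @^-1` A1 j `&` ws j @^-1` B1 j).
    apply/seteqP; split => t /=.
      move=> [At Bt] j _ /=; rewrite /A1 /B1.
      by case: eqP => // ->.
    by move=> /(_ i I); rewrite /A1 /B1 eqxx.
  rewrite -[LHS]fineK ?Q0//.
  apply: fin_num_measure; apply: fin_bigcap_measurable => //.
  by move=> j _; apply: measurableI; exact: measurable_preimage.
have Qnull : Q null = 0%E.
  apply/eqP; rewrite eq_le measure_ge0 andbT -[leRHS]/(0%R%:E) -[X in X%:E](mulr0 N%:R).
  apply: measure_bigsetU_ord_le => i; first exact: measurableU.
  apply: (le_trans (measureU2 _ _ _)) => //=.
  have := rect0 _ _ i (measurableC mS) measurableT (or_introl hsupp).
  rewrite preimage_setT setIT => ->.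
  have := rect0 _ _ i measurableT mB (or_intror PB).
  by rewrite preimage_setT setTI => ->; rewrite adde0.
pose U := \big[setU/set0]_(j < M1) bad j.
have mU : measurable U by exact: bigsetU_measurable.
exists (~` (U `|` null)); split; first by apply: measurableC; exact: measurableU.
split; last first.
  rewrite probability_setC; last exact: measurableU.
  rewrite EFinB leeB//; apply: (le_trans (measureU2 _ _ _)) => //.
  rewrite /= Qnull adde0.
  apply: (le_trans (measure_bigsetU_ord_le _ _ _ _ _ _ _ mbad Qbad)).
  by rewrite lee_fin mulrCA mulfV ?mulr1// gt_eqF.
move=> t /= /not_orP[nU nnull] x Xx.
have [j xj] := ycov x Xx.
have good i : S (zs i t) /\ ~ B (ws i t).
  split; [apply: contrapT|] => Bi; apply: nnull.
    by rewrite /null (bigD1 i)//=; left; left.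
  by rewrite /null (bigD1 i)//=; left; right.
have -> : FN t x = F t x.
  rewrite hFN /F; congr (_ * _); apply: eq_bigr => i _.
  by have [Si Bi] := good i; rewrite /h featureE.
have Fy : `|F t (y j) - f (y j)| <= u.
  rewrite leNgt; apply/negP => ub; apply: nU.
  by rewrite /U (bigD1 j)//=; left.
have e1 : C * (Lk * enorm (x - y j)) <= C * (Lk * eps).
  by rewrite !ler_wpM2l.
(* The two outer differences cost [C * Lk * eps] each; the middle one, at a centre, is at most
   [u]. *)
have -> : F t x - f x = (F t x - F t (y j)) + (F t (y j) - f (y j)) - (f x - f (y j)).
  by ring.
apply: (le_trans (ler_normB _ _)).
have -> : u + 2 * C * Lk * eps = C * (Lk * eps) + u + C * (Lk * eps) by ring.
apply: lerD; last exact: le_trans (f_lip _ _) e1.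
apply: (le_trans (ler_normD _ _)).
apply: lerD => //; exact: le_trans (F_lip _ _ _) e1.
Qed.
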